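(* Let $T$ be a nearly Gorenstein numerical semigroup which is not symmetric, and assume that $T$ is minimally generated by $n_1,\dots,n_\nu$. Then, for every $i\in\{1,\dots,\nu\}$, the elements of $\{n_1,\dots,\widehat{n_i},\dots,n_\nu\}$ (the set with $n_i$ omitted) are relatively coprime, i.e. their greatest common divisor is $1$.
   Context: A numerical semigroup is a submonoid $S$ of $\mathbb{N}=\{0,1,2,\dots\}$ with $\mathbb{N}\setminus S$ finite. Every numerical semigroup has a unique minimal set of generators, which is finite. $\mathrm{F}(S)=\max(\mathbb{Z}\setminus S)$ is the Frobenius number. $\mathrm{PF}(S)=\{f\in\mathbb{Z}\setminus S : f+s\in S \text{ for all } s\in S\setminus\{0\}\}$ is the set of pseudo-Frobenius numbers. $S$ is symmetric if $\mathrm{PF}(S)=\{\mathrm{F}(S)\}$. Put $M(S)=S\setminus\{0\}$, $K(S)=\{z\in\mathbb{Z} : \mathrm{F}(S)-z\notin S\}$, and $S-K(S)=\{z\in\mathbb{Z} : z+K(S)\subseteq S\}$. $S$ is nearly Gorenstein if $M(S)\subseteq K(S)+(S-K(S))$. *)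

(* Defs.v *)
From mathcomp Require Import all_boot all_order all_algebra.
From mathcomp Require Import boolp classical_sets cardinality.

Set Implicit Arguments.
Unset Strict Implicit.
Unset Printing Implicit Defensive.

Import Order.TTheory GRing.Theory Num.Theory.
Local Open Scope classical_set_scope.
Local Open Scope ring_scope.

Definition submonoid (S : set nat) : Prop :=
  S 0%N /\ forall x y : nat, S x -> S y -> S (x + y)%N.

Definition numerical_semigroup (S : set nat) : Prop :=
  submonoid S /\ finite_set (~` S).

Definition generated (A : set nat) : set nat := smallest submonoid A.

Definition minimal_generating_set (S A : set nat) : Prop :=
  generated A = S /\ forall B, B `<=` A -> generated B = S -> B = A.

Definition minimally_generated_by (S : set nat) (nu : nat)
    (n : 'I_nu -> nat) : Prop :=
  injective n /\ minimal_generating_set S (range n).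

Definition int_set (S : set nat) : set int := Posz @` S.

Definition is_max (A : set int) (m : int) : Prop :=
  A m /\ ubound A m.

(* The default value 0 is never used for a numerical semigroup: see
   frobeniusP. *)
Definition frobenius (S : set nat) : int := xget 0 (is_max (~` int_set S)).

Definition pseudo_frobenius (S : set nat) : set int :=
  [set f | ~ int_set S f /\
           forall s, int_set S s -> s != 0 -> int_set S (f + s)].

Definition symmetric_semigroup (S : set nat) : Prop :=
  pseudo_frobenius S = [set frobenius S].

Definition maximal_ideal (S : set nat) : set int := int_set S `\ 0.

Definition canonical_ideal (S : set nat) : set int :=
  [set z | ~ int_set S (frobenius S - z)].

Definition canonical_dual (S : set nat) : set int :=
  [set z | forall k, canonical_ideal S k -> int_set S (z + k)].

Definition nearly_gorenstein (S : set nat) : Prop :=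
  maximal_ideal S `<=`
  [set k + z | k in canonical_ideal S & z in canonical_dual S].

Lemma frobeniusP (S : set nat) :
  numerical_semigroup S -> is_max (~` int_set S) (frobenius S).
Proof.
move=> [_ /finite_seqP[s sE]].
have negS (z : int) : z < 0 -> ~ int_set S z by move=> z0 [m _ mz]; move: z0; rewrite -mz.
pose P m := `[< ~ int_set S (m%:Z - 1) >].
have exP : exists m, P m by exists 0%N; apply/asboolP/negS.
have ubP m : P m -> (m <= (\max_(i <- s) i).+1)%N.
  case: m => // m /asboolP; rewrite -addn1 PoszD addrK => mS.
  rewrite addn1 ltnS; apply: (@leq_bigmax_seq _ s xpredT id m) => //.
  by have : (~` S) m by [move=> Sm; apply: mS; exists m]; rewrite sE.
suff [m mP] : exists m, is_max (~` int_set S) m by exact: (xgetPex 0 (ex_intro _ m mP)).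
case: (ex_maxnP exP ubP) => m /asboolP Pm mmax; exists (m%:Z - 1); split=> // z nz.
have [z0|z0] := ltP z (-1); first by apply: (le_trans (ltW z0)); rewrite lerBrDl addrN.
have z1 : 0 <= z + 1 by rewrite -lerBlDr sub0r.
rewrite lerBrDr -(gez0_abs z1) lez_nat; apply: mmax.
by apply/asboolP; rewrite gez0_abs // addrK.
Qed.

(* Main.v *)
Require Import Defs.
From mathcomp Require Import all_boot all_order all_algebra.
From mathcomp Require Import boolp classical_sets cardinality.
From mathcomp Require Import zify ring.

(** Suppose that all generators except [g = n i] are divisible by some [d > 1].
    As [T] has finite complement, [g] is coprime to [d], so every integer is
    uniquely [r * g + w] with [0 <= r < d] and [d %| w], and membership in [T]
    and in [K(T)] depends only on [w]. Writing [g = k + z] with [k] in [K(T)]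
    and [z] in [T - K(T)], one finds that [z] is [0] or [g]. In both cases
    [K(T)] is contained in [T], so [T] is symmetric. *)

Set Implicit Arguments.
Unset Strict Implicit.
Unset Printing Implicit Defensive.

Import Order.TTheory GRing.Theory Num.Theory.
Local Open Scope classical_set_scope.
Local Open Scope ring_scope.

Lemma int_setD (S : set nat) (x y : int) :
  submonoid S -> int_set S x -> int_set S y -> int_set S (x + y).
Proof.
by move=> [_ SD] [a Sa <-] [b Sb <-]; exists (a + b)%N; [exact: SD|rewrite PoszD].
Qed.

Lemma int_setMn (S : set nat) (x : nat) (a : nat) :
  submonoid S -> S x -> int_set S (a%:Z * x%:Z).
Proof.
move=> Ssub Sx; elim: a => [|a IH]; first by exists 0%N; [exact: Ssub.1|lia].
have -> : a.+1%:Z * x%:Z = a%:Z * x%:Z + x%:Z by lia.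
by apply: int_setD => //; exists x.
Qed.

Lemma frobenius_notin (S : set nat) :
  numerical_semigroup S -> ~ int_set S (frobenius S).
Proof. by case/frobeniusP. Qed.

Lemma gt_frobenius_in (S : set nat) (x : int) :
  numerical_semigroup S -> frobenius S < x -> int_set S x.
Proof.
move=> /frobeniusP[_ Fub] ltFx; apply: contrapT => /Fub.
by rewrite leNgt ltFx.
Qed.

Lemma canonical_ideal_ge0 (S : set nat) (k : int) :
  numerical_semigroup S -> canonical_ideal S k -> 0 <= k.
Proof.
move=> Snum Kk; rewrite leNgt; apply/negP => k_lt0; apply: Kk.
by apply: gt_frobenius_in => //; lia.
Qed.

Lemma canonical_ideal0 (S : set nat) :
  numerical_semigroup S -> canonical_ideal S 0.
Proof. by move=> Snum; rewrite /canonical_ideal /= subr0; exact: frobenius_notin. Qed.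

(** A pseudo-Frobenius number [f] lies outside [S], hence outside the canonical ideal, so
    [frobenius S - f] is in [S]. If this difference were nonzero, adding it to [f] would put
    [frobenius S] in [S]. *)
Lemma symmetric_canonical (S : set nat) :
  numerical_semigroup S -> canonical_ideal S `<=` int_set S ->
  symmetric_semigroup S.
Proof.
move=> Snum KS; apply/seteqP; split => [f [Sf PFf]|f ->].
  have SFf : int_set S (frobenius S - f).
    by apply: contrapT => nSFf; apply: Sf; apply: KS.
  have [/eqP|Ff] := eqVneq (frobenius S - f) 0.
    by rewrite subr_eq0 => /eqP.
  by case: (frobenius_notin Snum); have := PFf _ SFf Ff; rewrite addrC subrK.
split=> [|s [m _ <-] m0]; first exact: frobenius_notin.
by apply: gt_frobenius_in => //; lia.
Qed.

(** This is all that the argument retains of the generators. The coefficient [a] may exceed [d], so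
    it is determined by [x] only modulo [d] when [g] and [d] are coprime. *)
Definition splits (S : set nat) (g d : nat) : Prop :=
  forall x, int_set S x ->
  exists (a : nat) (t : int), [/\ int_set S t, (d %| t)%Z & x = a%:Z * g%:Z + t].

(** The elements that split form a submonoid containing every generator: [n i] goes into the
    multiple of [g], any other [n j] into [t]. *)
Lemma splits_generated (nu : nat) (n : 'I_nu -> nat) (i : 'I_nu) (d : nat) :
  (forall j, j != i -> (d %| n j)%N) ->
  splits (generated (range n)) (n i) d.
Proof.
move=> dn _ [x + <-].
pose S := generated (range n).
have Ssub : submonoid S.
  split=> [B [[]]//|x1 x2 S1 S2 B BP].
  by have [[_ BD] _] := BP; apply: BD; [exact: S1|exact: S2].
apply: (@smallest_sub _ submonoid (range n)
  [set x : nat | exists (a : nat) (t : int),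
    [/\ int_set S t, (d %| t)%Z & x%:Z = a%:Z * (n i)%:Z + t]]).
  split=> [|x1 x2 [a1 [t1 [St1 dt1 e1]]] [a2 [t2 [St2 dt2 e2]]]].
    by exists 0%N, 0; split; [exists 0%N => //; exact: Ssub.1|exact: dvdz0|lia].
  exists (a1 + a2)%N, (t1 + t2); split; first exact: int_setD.
    exact: rpredD.
  by rewrite PoszD e1 e2 PoszD; ring.
move=> _ [j _ <-]; have [->|ji] := eqVneq j i.
  by exists 1%N, 0; split; [exists 0%N => //; exact: Ssub.1|exact: dvdz0|lia].
exists 0%N, (n j)%:Z; split; [|exact: dn|lia].
by exists (n j) => // B [_]; apply; exists j.
Qed.

(** The gcd of [g] and [d] divides all of [S], which contains two consecutive integers beyond the
    Frobenius number. *)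
Lemma splits_coprime (S : set nat) (g d : nat) :
  numerical_semigroup S -> splits S g d -> coprime g d.
Proof.
move=> Snum spl; pose e := gcdn g d.
have e_dvd x : int_set S x -> (e %| x)%Z.
  move=> /spl[a [t [_ dt ->]]]; apply: rpredD.
    by apply: dvdz_mull; exact: dvdn_gcdl.
  by apply: dvdz_trans dt; exact: dvdn_gcdr.
have : (e %| (frobenius S + 2) - (frobenius S + 1))%Z.
  by apply: rpredB; apply: e_dvd; apply: gt_frobenius_in => //; lia.
have -> : frobenius S + 2 - (frobenius S + 1) = 1 by ring.
by rewrite /coprime -dvdn1.
Qed.

Lemma coprime_decomp (g d : nat) (x : int) :
  (0 < d)%N -> coprime g d ->
  exists (r : nat) (w : int), [/\ (r < d)%N, (d %| w)%Z & x = r%:Z * g%:Z + w].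
Proof.
move=> d_gt0 cop.
have [u [v uv]] : exists u v : int, u * g%:Z + v * d%:Z = 1.
  have [u [v e]] := Bezoutz g d; exists u, v; rewrite e.
  by rewrite /gcdz /= (eqP cop).
have d0 : d%:Z != 0 by lia.
have r_ge0 := modz_ge0 (x * u) d0.
have r_lt := ltz_pmod (x * u) (d := d%:Z) ltac:(lia).
have xu := divz_eq (x * u) d%:Z.
(* Since [u] inverts [g] modulo [d], the digit [r] must be the residue of [x * u]. *)
exists `|(x * u %% d%:Z)%Z|%N, (x - (x * u %% d%:Z)%Z * g%:Z).
rewrite gez0_abs //; split; [lia| |ring].
apply/dvdzP; exists ((x * u %/ d%:Z)%Z * g%:Z + x * v).
have -> : (x * u %% d%:Z)%Z = x * u - (x * u %/ d%:Z)%Z * d%:Z by rewrite {2}xu; ring.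
rewrite -[X in X - _]mulr1 -uv; ring.
Qed.

(** Splitting the given element as [a * g + t] forces [a] to be congruent to [r] modulo [d]. As
    [r < d], this gives [r <= a], and [w = (a - r) * g + t] is in [S]. *)
Lemma splits_reduce (S : set nat) (g d r : nat) (w : int) :
  submonoid S -> S g -> coprime g d -> splits S g d ->
  (r < d)%N -> (d %| w)%Z -> int_set S (r%:Z * g%:Z + w) -> int_set S w.
Proof.
move=> Ssub Sg cop spl rd dw /spl[a [t [St dt e]]].
have dar : (d %| (a%:Z - r%:Z))%Z.
  rewrite -(@Gauss_dvdzl _ _ g%:Z) /coprimez; last first.
    by rewrite /gcdz /= gcdnC (eqP cop).
  have -> : (a%:Z - r%:Z) * g%:Z = w - t by move: e; lia.
  exact: rpredB.
have ra : (r <= a)%N.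
  rewrite leqNgt; apply/negP => ar.
  have : (d %| (r - a)%N%:Z)%Z by rewrite -subzn ?(ltnW ar) // -rpredN opprB.
  by rewrite dvdzE /= gtnNdvd; lia.
have -> : w = (a - r)%N%:Z * g%:Z + t.
  by rewrite -subzn //; move: e; lia.
by apply: int_setD => //; exact: int_setMn.
Qed.

(** The Frobenius number has the largest digit. With a digit [r < d - 1], adding [g] would give an
    element of [S] with digit [r + 1]; reduction would put [w], and then [frobenius S] itself, in
    [S]. *)
Lemma splits_frobenius (S : set nat) (g d : nat) :
  numerical_semigroup S -> S g -> (0 < g)%N -> (0 < d)%N -> splits S g d ->
  exists2 w : int, (d %| w)%Z & frobenius S = d.-1%:Z * g%:Z + w.
Proof.
move=> Snum Sg g_gt0 d_gt0 spl.
have cop := splits_coprime Snum spl.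
have [r [w [rd dw Fe]]] := coprime_decomp (frobenius S) d_gt0 cop.
exists w => //; have [->//|rd1] := eqVneq d.-1 r.
case: (frobenius_notin Snum); rewrite Fe; apply: int_setD; first exact: Snum.1.
  by apply: int_setMn => //; exact: Snum.1.
apply: (@splits_reduce S g d r.+1) => //; [exact: Snum.1|lia|].
by apply: gt_frobenius_in => //; rewrite Fe; lia.
Qed.

(** Because [frobenius S] has digit [d - 1], subtracting [r * g + w] from it never borrows: the
    digit becomes [d - 1 - r >= 0], so [splits_reduce] transfers to the canonical ideal. *)
Lemma splits_canonical_reduce (S : set nat) (g d r : nat) (w : int) :
  numerical_semigroup S -> S g -> (0 < g)%N -> splits S g d ->
  (r < d)%N -> (d %| w)%Z ->
  canonical_ideal S (r%:Z * g%:Z + w) -> canonical_ideal S w.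
Proof.
move=> Snum Sg g_gt0 spl rd dw; have Ssub := Snum.1.
have [|w' dw' Fe] := splits_frobenius Snum Sg g_gt0 _ spl; first by lia.
rewrite /canonical_ideal /= Fe => nS SFw; apply: nS.
have -> : d.-1%:Z * g%:Z + w' - (r%:Z * g%:Z + w)
        = (d.-1 - r)%N%:Z * g%:Z + (w' - w).
  by rewrite -subzn; [ring|lia].
apply: int_setD => //; first exact: int_setMn.
apply: (@splits_reduce S g d d.-1) => //.
- exact: splits_coprime spl.
- by lia.
- exact: rpredB.
- by rewrite addrA.
Qed.

Lemma splits_nearly_gorenstein_symmetric (S : set nat) (g d : nat) :
  numerical_semigroup S -> nearly_gorenstein S -> S g -> (1 < d)%N ->
  splits S g d -> symmetric_semigroup S.
Proof.
move=> Snum NG Sg d_gt1 spl; have Ssub := Snum.1.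
have cop := splits_coprime Snum spl.
have g_gt0 : (0 < g)%N.
  by case: g cop {Sg spl} => //; rewrite /coprime gcd0n => /eqP d1; rewrite d1 in d_gt1.
apply: symmetric_canonical => // x Kx.
have [|k Kk [z Dz kz]] := NG g%:Z; first by split; [exists g|apply/eqP; lia].
have Sz : int_set S z by rewrite -[z]addr0; apply: Dz; exact: canonical_ideal0.
have [a [t [[t' St' t'e] dt ze]]] := spl _ Sz.
have k_ge0 := canonical_ideal_ge0 Snum Kk.
(* If [a = 0], then [k = g - t] has digit 1, so [- t] is in the canonical ideal and [t <= 0]; being
   in [S], [t] is 0, and so is [z]. *)
case: a ze => [|a] ze.
  have Kt : canonical_ideal S (- t).
    apply: (@splits_canonical_reduce S g d 1) => //; first by rewrite rpredN.
    by have -> : 1%:Z * g%:Z + - t = k by lia.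
  have t_le0 := canonical_ideal_ge0 Snum Kt.
  have z0 : z = 0 by lia.
  by rewrite -[x]add0r -z0; exact: Dz.
(* Here [z] is at least [g] because its coefficient is positive and [t >= 0], and at most [g]
   because [k >= 0]. *)
have zg : z = g%:Z by nia.
have [r [w [rd dw xe]]] := coprime_decomp x (ltnW d_gt1) cop.
rewrite xe; apply: int_setD => //; first exact: int_setMn.
(* The part [w] of [x] is in the canonical ideal, so [g + w] is in [S]; removing the digit 1 leaves
   [w] in [S]. *)
apply: (@splits_reduce S g d 1) => //; rewrite mul1r -zg; apply: Dz.
by apply: (@splits_canonical_reduce S g d r) => //; rewrite -xe.
Qed.

Theorem corollary3p3 (T : set nat) (nu : nat) (n : 'I_nu -> nat) :
  numerical_semigroup T ->
  nearly_gorenstein T ->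
  ~ symmetric_semigroup T ->
  minimally_generated_by T n ->
  forall i : 'I_nu, \big[gcdn/0%N]_(j < nu | j != i) n j = 1%N.
Proof.
move=> Tnum NG nsym [_ [genT _]] i; apply: contrapT => gcd_neq1.
set D := \big[gcdn/0%N]_(j < nu | j != i) n j in gcd_neq1.
have D_dvd j : j != i -> (D %| n j)%N.
  by move=> ji; rewrite /D (bigD1 j) //= dvdn_gcdl.
have [d d_gt1 dD] : exists2 d, (1 < d)%N & (d %| D)%N.
  (* [D = 0] when there is no other generator. *)
  have [->|D0] := eqVneq D 0%N; first by exists 2%N.
  by exists D => //; move/eqP: gcd_neq1; lia.
apply: nsym; apply: (@splits_nearly_gorenstein_symmetric T (n i) d) => //.
  by rewrite -genT => B [_]; apply; exists i.
rewrite -genT; apply: splits_generated => j ji.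
exact: dvdn_trans dD (D_dvd j ji).
Qed.
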